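(* Let $G$ be a finite soluble group, let $g\in G$, and let $n$ be a positive integer. Let $R_n(g)=\langle [g,{}_{n}x] : x\in G\rangle$. If the Fitting height of $R_n(g)$ is equal to $k$, then $g\in F_{k+1}(G)$.
   Context: Commutators are $[a,b]=a^{-1}b^{-1}ab$. The Engel words are defined recursively by $[y,{}_{0}x]=y$ and $[y,{}_{i+1}x]=[[y,{}_{i}x],x]$. $R_n(g)$ is the subgroup of $G$ generated by all the elements $[g,{}_{n}x]$ with $x\in G$. For a finite group $H$, $F(H)$ denotes the Fitting subgroup (largest normal nilpotent subgroup). The Fitting series of $H$ is defined by $F_0(H)=1$ and $F_{i+1}(H)/F_i(H)=F(H/F_i(H))$. If $H$ is soluble, its Fitting height is the least integer $h\ge 0$ such that $F_h(H)=H$. *)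

(* Defs.v *)
From mathcomp Require Import all_boot all_fingroup all_solvable.

Set Implicit Arguments.
Unset Strict Implicit.
Unset Printing Implicit Defensive.

Import GroupScope.

(* The library's commutator is [~ x, y] = x^-1 * (y^-1 * (x * y)). *)
Definition engel (gT : finGroupType) (y x : gT) (n : nat) : gT :=
  iter n (fun z => [~ z, x]) y.

Definition right_engel_sub (gT : finGroupType) (G : {set gT}) (g : gT)
    (n : nat) : {set gT} :=
  <<[set engel g x n | x in G]>>.

(* F_(i+1)(A) is the full preimage of 'F(A / F_i(A)) in the normaliser of
   F_i(A). When A is a group this preimage lies in A; see
   fitting_series_normal and fitting_series_quotient. *)
Fixpoint fitting_series (gT : finGroupType) (i : nat) (A : {set gT}) :
    {set gT} :=
  if i is j.+1 then
    coset (fitting_series j A) @*^-1 'F(A / fitting_series j A)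
  else 1.

Definition has_fitting_height (gT : finGroupType) (A : {set gT}) (h : nat) :
    Prop :=
  fitting_series h A = A /\ forall i, fitting_series i A = A -> (h <= i)%N.

Lemma fitting_series_group_set (gT : finGroupType) i (H : {group gT}) :
  group_set (fitting_series i H).
Proof. by case: i => [|i]; apply: groupP. Qed.

Canonical fitting_series_group (gT : finGroupType) i (H : {group gT}) :=
  Group (fitting_series_group_set i H).

Lemma fitting_series_normal (gT : finGroupType) i (H : {group gT}) :
  fitting_series i H <| H.
Proof.
elim: i => [|i IHi] /=; first exact: normal1.
by rewrite -[X in _ <| X](quotientGK IHi) cosetpre_normal Fitting_normal.
Qed.

Lemma fitting_series_quotient (gT : finGroupType) i (H : {group gT}) :
  fitting_series i.+1 H / fitting_series i H = 'F(H / fitting_series i H).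
Proof. by rewrite /= cosetpreK. Qed.

Lemma solvable_fitting_height (gT : finGroupType) (H : {group gT}) :
  solvable H -> exists h, has_fitting_height H h.
Proof.
move=> solH.
have step i : (fitting_series i H == H) || (i < #|fitting_series i H|)%N.
  elim: i => [|i IHi]; first by rewrite cardG_gt0 orbT.
  have nFH := fitting_series_normal i H.
  have sFF : fitting_series i H \subset fitting_series i.+1 H.
    exact: sub_cosetpre.
  case/orP: IHi => [/eqP eqFH | ltiF].
    by rewrite eqEsubset (normal_sub (fitting_series_normal _ _)) -{1}eqFH sFF.
  have [eqF | neqF] := eqVneq (fitting_series i.+1 H) (fitting_series i H).
    have F1 : 'F(H / fitting_series i H) = 1.
      by rewrite -fitting_series_quotient eqF trivg_quotient.
    have/eqP H1 : H / fitting_series i H == 1.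
      by rewrite -trivg_Fitting ?quotient_sol //; apply/eqP.
    move/trivgP: H1; rewrite quotient_sub1 ?normal_norm // => sHF.
    by rewrite eqF eqEsubset sHF normal_sub.
  rewrite (leq_ltn_trans ltiF) ?orbT //.
  by apply: proper_card; rewrite properEneq eq_sym neqF sFF.
have ex : exists i, fitting_series i H == H.
  exists #|H|; case/orP: (step #|H|) => //.
  by rewrite ltnNge subset_leq_card ?normal_sub ?fitting_series_normal.
exists (ex_minn ex); case: ex_minnP => h /eqP eqh minh.
by split=> // i /eqP; apply: minh.
Qed.

(* Main.v *)
(* Residuals replace the Fitting series: a group has Fitting height at most i
   iff its i-th iterated nilpotent residual is trivial.  In a minimal
   counterexample, where R = R_n(g), G is the normal closure of g, and every
   nontrivial normal subgroup contains the (k+1)-st residual; so F(G) = O_p(G)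
   is its own centraliser, and O_p(G) is abelian since we may factor out
   'Phi('O_p(G)).  As G modulo its nilpotent residual is cyclic, R lies in that
   residual, so the last nontrivial residual L of R maps to a p'-group in
   G / O_p(G).  Minimality also gives that L is not contained in O_p(G), whence
   A = O_p'(L) is nontrivial.  It is normalised by 'C_G[g] and centralises
   R :&: O_p(G), which forces A to centralise O_p(G), a contradiction.  For
   k = 0 the subgroup <[g]> plays the role of L. *)

Require Import Defs.
From mathcomp Require Import all_boot all_fingroup all_solvable.

Set Implicit Arguments.
Unset Strict Implicit.
Unset Printing Implicit Defensive.

Import GroupScope.

(** * Fitting subgroups and p-cores containing their centralisers *)

Lemma central_ext_nil (gT : finGroupType) (M Z : {group gT}) :
  Z <| M -> Z \subset 'C(M) -> nilpotent (M / Z) -> nilpotent M.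
Proof.
move=> nsZM cMZ /lcnP[n Ln1]; apply/lcnP; exists n.+1.
have sLZ : 'L_n.+1(M) \subset Z.
  rewrite -quotient_sub1; last exact: subset_trans (lcn_sub _ _) (normal_norm _).
  by rewrite -Ln1 /quotient morphim_lcn ?normal_norm.
by rewrite lcnSn; apply/commG1P; apply: subset_trans sLZ cMZ.
Qed.

(** ['F(C)] lies in ['F(G)], so it is central in [C]. The preimage of ['F(C / 'F(C))] is then
    nilpotent and normal, hence equal to ['F(C)], and solubility gives [C = 'F(C)]. *)
Lemma sol_cent_Fitting (gT : finGroupType) (G : {group gT}) :
  solvable G -> 'C_G('F(G)) \subset 'F(G).
Proof.
move=> solG; set C := ('C_G('F(G)))%G.
have nsCG : C <| G.
  by rewrite /normal subsetIl normsI ?normG ?norms_cent ?gFnorm.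
have sFCG : 'F(C) \subset 'F(G).
  by rewrite Fitting_max ?Fitting_nil ?gFnormal_trans.
have cCF : 'F(C) \subset 'C(C).
  by rewrite centsC (subset_trans (subsetIr _ _)) ?centS.
suff sCF : C \subset 'F(C) by apply: subset_trans sCF sFCG.
have nsFC := Fitting_normal C.
rewrite -quotient_sub1 ?gFnorm // subG1.
rewrite -trivg_Fitting ?quotient_sol ?(solvableS (normal_sub nsCG)) //.
have [M /= qM sFM nsMC] := inv_quotientN nsFC (Fitting_normal (C / 'F(C))%G).
rewrite qM; apply/eqP/quotientS1; apply: Fitting_max (nsMC) _.
apply: (central_ext_nil (Z := 'F(C))).
- exact: normalS sFM (normal_sub nsMC) nsFC.
- exact: subset_trans cCF (centS (normal_sub nsMC)).
- by rewrite -qM Fitting_nil.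
Qed.

(** By Schur-Zassenhaus the p'-core lifts to a p'-group [A]. It acts trivially on [P / 'Phi(P)],
    hence on [P], so it lies in [P] and is trivial. *)
Lemma pcore_quotient_Phi (gT : finGroupType) (p : nat) (G : {group gT}) :
  'C_G('O_p(G)) \subset 'O_p(G) -> 'O_p^'(G / 'Phi('O_p(G))) = 1.
Proof.
set P := 'O_p(G)%G => sCP.
have pP : p.-group P := pcore_pgroup p G.
have nsPG : P <| G := pcore_normal p G.
have nsFG : 'Phi(P) <| G by rewrite gFnormal_trans.
have nFG := normal_norm nsFG.
have [K /= qK sFK nsKG] :=
  inv_quotientN nsFG (pcore_normal p^' (G / 'Phi(P))%G).
have sKG := normal_sub nsKG.
have nsFK : 'Phi(P) <| K := normalS sFK sKG nsFG.
have pF : p.-group 'Phi(P) := pgroupS (Phi_sub P) pP.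
have p'Q : p^'.-group (K / 'Phi(P)) by rewrite -qK pcore_pgroup.
have hallF : Hall K 'Phi(P).
  rewrite /Hall sFK (pnat_coprime pF) // -card_quotient ?normal_norm //.
have /splitsP[A /complP[tiFA defK]] := SchurZassenhaus_split hallF nsFK.
have sAK : A \subset K by rewrite -defK mulG_subr.
have sAG := subset_trans sAK sKG.
have nFA := subset_trans sAG nFG.
have nPA : A \subset 'N(P) := subset_trans sAG (normal_norm nsPG).
have nFP : P \subset 'N('Phi(P)) := gFnorm _ _.
have qA : A / 'Phi(P) = K / 'Phi(P) by rewrite -defK quotientMidl.
have p'A : p^'.-group A.
  rewrite /pgroup (card_isog (quotient_isog nFA tiFA)) /=.
  by move: p'Q; rewrite -qA.
have cPA : P / 'Phi(P) \subset 'C(A / 'Phi(P)).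
  rewrite qA -qK; apply/commG1P/trivgP.
  have pPq : p.-group (P / 'Phi(P)) := quotient_pgroup _ pP.
  rewrite -(coprime_TIg (pnat_coprime pPq (pcore_pgroup p^' (G / 'Phi(P))))).
  rewrite commg_subI // subsetI subxx /=.
    by rewrite (subset_trans (quotientS _ (normal_sub nsPG))) ?gFnorm.
  by rewrite (subset_trans (pcore_sub _ _)) ?quotient_norms ?normal_norm.
(* Coprime action lifts fixed points, so [P] is generated by ['C_P(A)] and ['Phi(P)]; Frattini
   elements are nongenerators. *)
have defP : 'C_P(A) = P.
  rewrite -[LHS]genGid; apply: Phi_nongen.
  rewrite norm_joinEr ?subIset ?nFP //; apply/eqP.
  rewrite eqEsubset mul_subG ?Phi_sub ?subsetIl //= -quotientSK //.
  rewrite coprime_norm_quotient_cent ?(nilpotent_sol (pgroup_nil pF)) //.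
    by rewrite subsetI subxx.
  exact: pnat_coprime pF p'A.
have sAP : A \subset P.
  by apply: subset_trans sCP; rewrite subsetI sAG centsC; apply/setIidPl.
have A1 : A :=: 1 by rewrite -(setIidPl sAP) setIC coprime_TIg ?(pnat_coprime pP).
by rewrite qK -qA A1 quotient1.
Qed.


(** * Engel words and coprime action on abelian normal subgroups *)

(** The first commutator is [(v^-1)^g * v], in [V], and on [V] commutation with [g * v] agrees with
    commutation with [g]. *)
Lemma engel_mulg_norm (gT : finGroupType) (V : {group gT}) (g v : gT) n :
    abelian V -> v \in V -> g \in 'N(V) -> (0 < n)%N ->
  engel g (g * v) n = engel v^-1 g n.
Proof.
move=> abV Vv nVg; case: n => // n _.
have VR w : w \in V -> [~ w, g] \in V.
  by move=> Vw; rewrite commgEl groupM ?groupV // memJ_norm.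
have VE i : engel v^-1 g i \in V.
  by elim: i => [|i IHi]; [rewrite groupV | apply: VR].
elim: n => [|n IHn].
  have comv : commute v ((v^-1) ^ g).
    by apply: (centsP abV); rewrite ?memJ_norm ?groupV.
  rewrite /engel /= [RHS]commgEl invgK comv.
  by rewrite /commg /conjg invMg !mulgA mulgKV.
rewrite /engel iterS -/(engel _ _ _) IHn [RHS]iterS -/(engel _ _ _).
have Vw := VE n.+1; set w := engel v^-1 g n.+1 in Vw *.
rewrite !commgEl conjgM [(w ^ g) ^ v]conjgE.
by rewrite -(centsP abV v Vv (w ^ g)) ?memJ_norm // mulKg.
Qed.

(** The elements of [W] killed by [w |-> [w, g]] form ['C_W[g]], so its triviality lets [n] drop one
    step at a time. *)
Lemma engel_nil_TI (gT : finGroupType) (W : {group gT}) (g : gT) n :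
    g \in 'N(W) -> {in W, forall w, engel w g n = 1} -> 'C_W[g] = 1 ->
  W :=: 1.
Proof.
move=> nWg; elim: n => [|n IHn] engW1 CW1.
  by apply/trivgP/subsetP=> w /engW1; rewrite inE /engel /= => ->.
apply: IHn (CW1) => w Ww; apply/set1P; rewrite -[[set 1]]CW1 inE.
have -> : engel w g n \in W.
  elim: n {engW1} => [|n IHn] //; rewrite /engel iterS commgEl.
  by rewrite groupM ?groupV // memJ_norm.
by apply/cent1P/commgP/eqP; apply: engW1.
Qed.

(* On [W = [V, A]] the operator [w |-> [w, g]] is nilpotent, as its n-th power
   sends W into [R :&: W <= 'C_W(A) = 1]; but its kernel ['C_W(g)] normalises A,
   hence also lies in ['C_W(A) = 1]. *)
Lemma engel_coprime_cent (gT : finGroupType) (G V A : {group gT}) (g : gT) n :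
    (0 < n)%N -> g \in G -> V <| G -> abelian V -> A \subset G ->
    coprime #|V| #|A| -> g \in 'N(A) -> 'C_V[g] \subset 'N(A) ->
    right_engel_sub G g n :&: V \subset 'C(A) ->
  A \subset 'C(V).
Proof.
move=> n_gt0 Gg nsVG abV sAG coVA nAg nAC cRA.
have [sVG nVG] := andP nsVG; have nVA := subset_trans sAG nVG.
have nVg := subsetP nVG g Gg.
have CWA := coprime_abel_cent_TI nVA coVA abV.
have sWV : [~: V, A] \subset V by rewrite commg_subl.
have nWg : g \in 'N([~: V, A]).
  by rewrite -cycle_subG normsR // cycle_subG.
have CW w : w \in [~: V, A] -> w \in 'C(A) -> w = 1.
  by move=> Ww cAw; apply/set1P; rewrite -[[set 1]]CWA inE Ww.
rewrite centsC; apply/commG1P; apply: (engel_nil_TI (n := n) nWg).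
  move=> w Ww; have Vw := subsetP sWV w Ww.
  have Ew : engel w g n \in [~: V, A].
    elim: (n) => [|i IHi] //; rewrite /engel iterS commgEl.
    by rewrite groupM ?groupV // memJ_norm.
  apply: CW => //; apply: (subsetP cRA).
  (* The generator of [R_n(g)] used here is the one with [x = g * w^-1]. *)
  rewrite inE (subsetP sWV) // andbT -[w]invgK.
  rewrite -(engel_mulg_norm abV) ?groupV // mem_gen //.
  apply: (imset_f (fun x => engel g x n)).
  by rewrite groupM // groupV; apply: (subsetP sVG).
apply/trivgP/subsetP=> w /setIP[Ww cgw]; have Vw := subsetP sWV w Ww.
have nAw : w \in 'N(A) by apply: (subsetP nAC); rewrite inE Vw.
rewrite inE; apply/eqP; apply: CW => //.
rewrite -cycle_subG; apply/commG1P/trivgP.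
rewrite -(coprime_TIg coVA) commg_subI // subsetI ?cycle_subG ?Vw //.
by rewrite subxx.
Qed.

(** * Iterated nilpotent residuals and the Fitting series *)

(* With N at least the order of G, 'L_N.+1 is the nilpotent residual on all
   sections of G; keeping N fixed makes nil_res commute with quotients. *)
Definition nil_res (N i : nat) (gT : finGroupType) (G : {group gT}) :
    {group gT} :=
  iter i (fun H => 'L_N.+1(H)%G) G.

Section NilRes.

Variables (gT : finGroupType) (N : nat).
Implicit Types A B G H : {group gT}.

Lemma lcn_nilP G : #|G| <= N -> reflect ('L_N.+1(G) = 1) (nilpotent G).
Proof.
move=> leGN; apply: (iffP idP) => [nilG | L1]; last by apply/lcnP; exists N.
apply/(lcn_nil_classP _ nilG); apply: leq_trans leGN; apply: ltnW.
by rewrite -nilpotent_class.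
Qed.

Lemma nil_resS i G : nil_res N i.+1 G = 'L_N.+1(nil_res N i G) :> {set gT}.
Proof. by []. Qed.

Lemma nil_resSr i G : nil_res N i.+1 G = nil_res N i 'L_N.+1(G)%G.
Proof. by rewrite /nil_res iterSr. Qed.

Lemma nil_res_char i G : nil_res N i G \char G.
Proof.
elim: i => [|i IHi]; first exact: char_refl.
exact: char_trans (lcn_char _ _) IHi.
Qed.

Lemma nil_res_sub i G : nil_res N i G \subset G.
Proof. exact: char_sub (nil_res_char i G). Qed.

Lemma nil_resSS i A B : A \subset B -> nil_res N i A \subset nil_res N i B.
Proof. by elim: i => // i IHi sAB; rewrite !nil_resS lcnS ?IHi. Qed.

Lemma morphim_nil_res (rT : finGroupType) (D : {group gT})
    (f : {morphism D >-> rT}) i G :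
  G \subset D -> f @* nil_res N i G = nil_res N i (f @* G)%G.
Proof.
move=> sGD; elim: i => // i IHi; rewrite !nil_resS.
rewrite morphim_lcn ?(subset_trans (nil_res_sub _ _)) //.
by congr ('L_N.+1(_)); apply: IHi.
Qed.

Lemma nil_resJ i G x : nil_res N i (G :^ x)%G = nil_res N i G :^ x :> {set gT}.
Proof.
have -> : (G :^ x)%G = (conjgm G x @* G)%G.
  by apply/val_inj; rewrite /= morphim_conj setIid.
rewrite -morphim_nil_res // morphim_conj.
by rewrite (setIidPr (nil_res_sub i G)).
Qed.

Lemma nil_res1S i A B :
  A \subset B -> nil_res N i B = 1%G -> nil_res N i A = 1%G.
Proof. by move=> sAB B1; apply/trivGP; rewrite -[1]/(gval 1%G) -B1 nil_resSS. Qed.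

End NilRes.

(** By induction the residual of [A], normal in [B], lies in the [i]-th term, so [A] has nilpotent
    normal image modulo that term. *)
Lemma sub_fitting_series (gT : finGroupType) N i (A B : {group gT}) :
    #|B| <= N -> A <| B -> nil_res N i A = 1%G -> A \subset fitting_series i B.
Proof.
move=> leBN; elim: i A => [|i IHi] A nsAB; first by rewrite /nil_res /= => ->.
rewrite nil_resSr => /IHi sLF.
have nsFB := fitting_series_normal i B; have nFB := normal_norm nsFB.
have nFA := subset_trans (normal_sub nsAB) nFB.
have {}sLF : 'L_N.+1(A) \subset fitting_series i B.
  by apply: sLF; rewrite gFnormal_trans.
rewrite /= -sub_quotient_pre //; apply: Fitting_max; first exact: quotient_normal.
apply/lcnP; exists N; rewrite -morphim_lcn //.
exact: quotientS1.
Qed.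

Lemma nil_res_fitting_series (gT : finGroupType) N i (B : {group gT}) :
  #|B| <= N -> nil_res N i (fitting_series i B)%G = 1%G.
Proof.
move=> leBN; elim: i => [|i IHi]; first exact/val_inj.
rewrite nil_resSr; apply: nil_res1S IHi => /=.
have nsFB := fitting_series_normal i B; have nFB := normal_norm nsFB.
have nsF1B := fitting_series_normal i.+1 B.
have nFF := subset_trans (normal_sub nsF1B) nFB.
rewrite -quotient_sub1; last by apply: subset_trans (lcn_sub _ _) _.
rewrite /quotient morphim_lcn //.
have nilQ : nilpotent (fitting_series i.+1 B / fitting_series i B).
  by rewrite fitting_series_quotient Fitting_nil.
have leQN : #|fitting_series i.+1 B / fitting_series i B| <= N.
  apply: leq_trans leBN; apply: leq_trans (leq_morphim _ _) _.
  exact: subset_leq_card (normal_sub nsF1B).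
by rewrite (lcn_nilP leQN nilQ).
Qed.

(** The [i]-th Fitting term of [D] contains [E] and is invariant under [G], so it contains every
    conjugate of [g]. *)
Lemma nil_res_product_closed (gT : finGroupType) N i (D G E : {group gT})
    (g : gT) :
    #|D| <= N -> D = <<g ^: G>> :> {set gT} -> D <| G -> E <| D -> g \in E ->
  nil_res N i E = 1%G -> nil_res N i D = 1%G.
Proof.
move=> leDN defD nsDG nsED Eg E1; set F := fitting_series_group i D.
have sEF : E \subset F by apply: sub_fitting_series E1.
have F1 : nil_res N i F = 1%G by apply: nil_res_fitting_series.
have sFF x : x \in G -> F :^ x \subset F.
  move=> Gx; have nDx := normsP (normal_norm nsDG) x Gx.
  apply: (@sub_fitting_series _ N i (F :^ x)%G) => //.
    by rewrite -nDx /= normalJ fitting_series_normal.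
  by apply/val_inj; rewrite /= nil_resJ F1 conjs1g.
suff sDF : D \subset F.
  exact: nil_res1S sDF F1.
rewrite defD gen_subG; apply/subsetP=> _ /imsetP[x Gx ->].
by apply: subsetP (sFF x Gx) _ _; rewrite memJ_conjg (subsetP sEF).
Qed.

(** * Groups generated by one conjugacy class *)

(** If [<[x]>] were proper, being subnormal it would lie in a proper normal subgroup, which would
    contain the whole class of [x]. *)
Lemma nilpotent_class_gen (gT : finGroupType) (X : {group gT}) x :
  nilpotent X -> x \in X -> <<x ^: X>> = X -> <[x]> = X.
Proof.
move=> nilX Xx defX; have sxX : <[x]> \subset X by rewrite cycle_subG.
have [//|[K [/subnormal_sub sxK nsKX]]] :=
  subnormalEr (nilpotent_subnormal nilX sxX).
rewrite properE => /andP[_ /negP[]]; rewrite -{1}defX gen_subG.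
by rewrite class_sub_norm ?normal_norm // -cycle_subG.
Qed.

Lemma der1_class_gen (gT : finGroupType) N (G : {group gT}) g :
  #|G| <= N -> g \in G -> <<g ^: G>> = G -> G^`(1) \subset 'L_N.+1(G).
Proof.
move=> leGN Gg defG; have nLG : G \subset 'N('L_N.+1(G)) by rewrite gFnorm.
apply: der1_min => //.
have nLg := subsetP nLG g Gg.
suff <- : <[coset 'L_N.+1(G) g]> = G / 'L_N.+1(G) by apply: cycle_abelian.
apply: nilpotent_class_gen.
- apply/lcnP; exists N.
  by rewrite -morphim_lcn //; apply: quotientS1.
- exact: mem_quotient.
- rewrite -[X in _ = X / _]defG /quotient morphim_gen.
    by rewrite -quotient_class.
  by apply: subset_trans nLG; rewrite class_subG.
Qed.

(** * The subgroups [R_n(g)] *)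

Lemma right_engel_sub_mono (gT : finGroupType) (D G : {group gT}) g n :
  D \subset G -> right_engel_sub D g n \subset right_engel_sub G g n.
Proof. by move=> sDG; apply/genS/imsetS. Qed.

Lemma right_engel_sub_der (gT : finGroupType) (G : {group gT}) g n :
  0 < n -> g \in G -> right_engel_sub G g n \subset G^`(1).
Proof.
case: n => // n _ Gg; rewrite gen_subG; apply/subsetP=> _ /imsetP[x Gx ->].
have: engel g x n \in G.
  by elim: n => // n IHn; rewrite /engel iterS groupR.
by move=> Gy; rewrite /engel iterS mem_commg.
Qed.

Lemma engelJ (gT : finGroupType) (g x c : gT) n :
  engel g x n ^ c = engel (g ^ c) (x ^ c) n.
Proof. by elim: n => // n IHn; rewrite /engel !iterS conjRg; congr [~ _, _]. Qed.

Lemma right_engel_sub_cent (gT : finGroupType) (G : {group gT}) g n :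
  'C_G[g] \subset 'N(right_engel_sub G g n).
Proof.
apply/subsetP=> c /setIP[Gc /cent1P cgc]; apply/normP.
have gc : g ^ c = g by rewrite /conjg -cgc mulKg.
rewrite /right_engel_sub -genJ; congr <<_>>; apply/setP=> z.
rewrite mem_conjg; apply/imsetP/imsetP=> [] [x Gx].
  move/(canRL (conjgKV _))->; exists (x ^ c); rewrite ?groupJ //.
  by rewrite engelJ gc.
move=> ->; exists (x ^ c^-1); rewrite ?groupJ ?groupV // engelJ.
by rewrite -{1}gc conjgK.
Qed.

Lemma quotient_right_engel_sub (gT : finGroupType) (M G : {group gT}) g n :
    M <| G -> g \in G ->
  right_engel_sub G g n / M = right_engel_sub (G / M) (coset M g) n.
Proof.
move=> /andP[sMG nMG] Gg; have nMg := subsetP nMG g Gg.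
have E x : x \in G ->
    engel g x n \in 'N(M)
    /\ coset M (engel g x n) = engel (coset M g) (coset M x) n.
  move=> Gx; have nMx := subsetP nMG x Gx.
  elim: n => [|i [nMy IHi]] //; rewrite /engel !iterS -!/(engel _ _ _) -IHi.
  by rewrite groupR // morphR.
rewrite /quotient morphim_gen; last first.
  by apply/subsetP=> _ /imsetP[x /E[nMy _] ->].
congr <<_>>; apply/setP=> z; apply/idP/imsetP.
  case/morphimP=> y _ /imsetP[x Gx ->] ->; exists (coset M x).
    by rewrite mem_quotient.
  by case: (E x Gx).
case=> _ /morphimP[x _ Gx ->] ->; case: (E x Gx) => nMy <-.
by apply: mem_morphim => //; apply: (imset_f (fun x => engel g x n)).
Qed.

Canonical right_engel_group (gT : finGroupType) (G : {set gT}) (g : gT) n :=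
  Eval hnf in [group of right_engel_sub G g n].

(** * The minimal counterexample *)

Lemma nil_p'group (gT : finGroupType) (pi : nat_pred) (G : {group gT}) :
  nilpotent G -> 'O_pi(G) = 1 -> pi^'.-group G.
Proof.
move=> nilG Op1; have /dprodP[_ <- _ _] := nilpotent_pcoreC pi nilG.
by rewrite Op1 mul1g pcore_pgroup.
Qed.

(** The assumption on [M] is the induction hypothesis in [G / M]. It is stated for all [j] because
    it serves twice: at [k] for every nontrivial [M], and at [k - 1] for [M = P]. *)
Lemma class_gen_nil_res (gT : finGroupType) N (G : {group gT}) g n k :
    solvable G -> g \in G -> 0 < n -> #|G| <= N -> <<g ^: G>> = G ->
    (forall (M : {group gT}) j, M <| G -> M :!=: 1 ->
       nil_res N j (right_engel_group G g n) \subset M ->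
       nil_res N j.+1 G \subset M) ->
    nil_res N k (right_engel_group G g n) = 1%G ->
  nil_res N k.+1 G = 1%G.
Proof.
move=> solG Gg n_gt0 leGN defG IHG; set R := right_engel_group G g n => R1.
set U := nil_res N k.+1 G; set Y := nil_res N k G.
suff: U :==: 1 by move/eqP=> U1; apply/val_inj.
apply: contraT => ntU.
have sRG : R \subset G.
  exact: subset_trans (right_engel_sub_der n_gt0 Gg) (der_sub 1 G).
have sYG : Y \subset G := nil_res_sub _ _ _.
have nsYG : Y <| G := char_normal (nil_res_char _ _ _).
have Ynil : ~ nilpotent Y.
  move=> nilY; case/eqP: ntU; apply/lcn_nilP=> //.
  exact: leq_trans (subset_leq_card sYG) leGN.
have sUM (M : {group gT}) : M <| G -> M :!=: 1 -> U \subset M.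
  by move=> nsMG ntM; apply: IHG; rewrite // R1 sub1G.
have nilYq (M : {group gT}) : M <| G -> U \subset M -> nilpotent (Y / M).
  move=> nsMG sUM'; apply/lcnP; exists N.
  rewrite -morphim_lcn ?(subset_trans sYG) ?normal_norm //.
  exact: quotientS1.
have ntG : G :!=: 1.
  apply: contraNneq ntU => G1; apply/eqP/trivgP.
  by apply: subset_trans (nil_res_sub _ _ _) _; rewrite G1.
have [p ntP] : exists p : nat, 'O_p(G) != 1.
  exists (pdiv #|'F(G)|); rewrite -p_core_Fitting -cardG_gt1 /=.
  rewrite (card_Hall (nilpotent_pcore_Hall _ (Fitting_nil G))).
  by rewrite p_part_gt1 pi_pdiv cardG_gt1 trivg_Fitting.
(* Otherwise [U] would lie in both ['O_p(G)] and ['O_p^'(G)]. *)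
have p'G1 : 'O_p^'(G) = 1.
  apply/eqP; apply: contraT => ntP'; case/negP: ntU.
  rewrite -subG1 -(TI_pcoreC p G G) subsetI.
  by rewrite !(sUM _%G) ?pcore_normal.
set P := 'O_p(G)%G.
have nsPG : P <| G := pcore_normal p G.
have pP : p.-group P := pcore_pgroup p G.
have nPG := normal_norm nsPG.
have sCP : 'C_G(P) \subset P.
  by rewrite /= -(Fitting_eq_pcore p'G1) sol_cent_Fitting.
have nsFG : 'Phi(P) <| G by rewrite gFnormal_trans.
(* Otherwise [Y / 'Phi(P)] would lie in the Fitting subgroup of [G / 'Phi(P)], a p-group, making [Y]
   nilpotent. *)
have Phi1 : 'Phi(P) == 1.
  apply: contraT => ntPhi; case: Ynil; apply: (@pgroup_nil _ p).
  have pF : p.-group 'Phi(P) := pgroupS (Phi_sub P) pP.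
  rewrite -(pquotient_pgroup pF) ?(subset_trans sYG) ?normal_norm //.
  have defF : 'F(G / 'Phi(P)) = 'O_p(G / 'Phi(P)).
    exact: Fitting_eq_pcore (pcore_quotient_Phi sCP).
  suff: Y / 'Phi(P) \subset 'O_p(G / 'Phi(P)).
    by move/pgroupS->; rewrite ?pcore_pgroup.
  by rewrite -defF Fitting_max ?quotient_normal ?nilYq ?(sUM 'Phi(P)%G).
have abP : abelian P by apply: (@abelem_abelian _ p); rewrite -trivg_Phi.
have p'Y : p^'.-group (Y / P).
  apply: pgroupS (nil_p'group (Fitting_nil (G / P)) _).
    by rewrite Fitting_max ?quotient_normal ?nilYq ?sUM.
  by rewrite p_core_Fitting trivg_pcore_quotient.
(* Common end of both cases: once ['O_p^'(L)] is trivial, [L] is a p-group with p'-image modulo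
   [P]. *)
have sLP (L : {group gT}) : nilpotent L -> L \subset Y ->
    'C_G[g] \subset 'N(L) -> R :&: P \subset 'C('O_p^'(L)) -> L \subset P.
  move=> nilL sLY nLC cRL; have sLG := subset_trans sLY sYG.
  have nAC : 'C_G[g] \subset 'N('O_p^'(L)) by apply: gFnorm_trans.
  have sAG : 'O_p^'(L) \subset G by apply: subset_trans (pcore_sub _ _) sLG.
  have coPA : coprime #|P| #|'O_p^'(L)| := pnat_coprime pP (pcore_pgroup _ _).
  have cPA : 'O_p^'(L) \subset 'C(P).
    apply: (@engel_coprime_cent _ G _ _ g n) => //.
      by rewrite (subsetP nAC) // inE Gg cent1id.
    by apply: subset_trans nAC; rewrite setSI ?normal_sub.
  have A1 : 'O_p^'(L) = 1.
    apply/eqP; rewrite -subG1 -(coprime_TIg coPA) subsetI subxx andbT.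
    by apply: subset_trans sCP; rewrite subsetI sAG.
  have pL : p.-group L.
    by rewrite -(eq_pgroup _ (negnK _)) nil_p'group.
  rewrite -quotient_sub1 ?(subset_trans sLG) // -(setIid (L / P)).
  rewrite -[X in _ :&: X](setIidPl (quotientS P sLY)).
  by rewrite setIA setIid coprime_TIg ?(pnat_coprime (quotient_pgroup P pL)).
(* For [k = 0], [Y] is [G] and [R] is trivial; [g] in [P] would make [G] a p-group. *)
case: k => [|k] in @U @Y R1 ntU sYG nsYG Ynil sUM nilYq p'Y sLP *.
  case: Ynil; apply: (@pgroup_nil _ p); apply: pgroupS pP.
  rewrite -defG gen_subG class_sub_norm // -cycle_subG sLP ?cycle_subG //.
  - exact: abelian_nil (cycle_abelian g).
  - by rewrite cents_norm // cent_cycle subsetIr.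
  - by rewrite [R]R1 setIC (setIidPr (sub1G P)) sub1G.
set L := nil_res N k R.
have chL : L \char R := nil_res_char _ _ _.
have sLR := char_sub chL.
(* With [M = P], the inclusion of [L] in [P] would put [Y] in [P]. *)
case: Ynil; apply: (@pgroup_nil _ p); apply: pgroupS (pP); apply: IHG => //.
apply: sLP.
- by apply/lcnP; exists N; rewrite -nil_resS R1.
(* [R] already lies in the first residual of [G], which makes up for the index shift between [L] and
   [Y]. *)
- rewrite /Y nil_resSr nil_resSS //.
  apply: subset_trans (right_engel_sub_der n_gt0 Gg) _.
  exact: der1_class_gen leGN Gg defG.
- exact: char_norm_trans chL (right_engel_sub_cent _ _ _).
(* [R :&: P] normalises ['O_p^'(L)], so their commutator lies in [P :&: 'O_p^'(L) = 1]. *)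
apply/commG1P/trivgP.
rewrite -(coprime_TIg (pnat_coprime pP (pcore_pgroup p^' L))).
have sAG : 'O_p^'(L) \subset G.
  by rewrite (subset_trans (pcore_sub _ _)) ?(subset_trans sLR).
rewrite commg_subI // subsetI ?subsetIr ?subxx /= ?(subset_trans sAG) //.
by rewrite (subset_trans (subsetIl _ _)) // gFnorm_trans ?char_norm.
Qed.

(** Bounding the normal closure of [g] instead of placing [g] in a Fitting term suits induction on
    the order through subgroups and quotients. *)
Lemma engel_nil_res (gT : finGroupType) N (G : {group gT}) g n k :
    solvable G -> g \in G -> 0 < n -> #|G| <= N ->
    nil_res N k (right_engel_group G g n) = 1%G ->
  nil_res N k.+1 <<g ^: G>>%G = 1%G.
Proof.
move=> solG Gg n_gt0; have [m] := ubnP #|G|.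
elim: m gT G g k solG Gg => // m IHm gT G g k solG Gg /ltnSE-leGm leGN R1.
set D := <<g ^: G>>%G.
have nsDG : D <| G by rewrite /normal gen_subG class_subG ?norms_gen ?class_norm.
have sDG := normal_sub nsDG.
have Dg : g \in D by rewrite mem_gen ?class_refl.
have leDN := leq_trans (subset_leq_card sDG) leGN.
(* For proper [D], induction bounds only the normal closure of [g] in [D]; [nil_res_product_closed]
   extends this to [D]. *)
have [defD | ltDG] := eqVproper sDG; last first.
  have nsED : <<g ^: D>> <| D.
    by rewrite /normal gen_subG class_subG ?norms_gen ?class_norm.
  apply: (nil_res_product_closed leDN _ nsDG nsED) => //=.
    by rewrite mem_gen ?class_refl.
  apply: IHm => //; first exact: solvableS solG.
    exact: leq_trans (proper_card ltDG) leGm.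
  exact: nil_res1S (right_engel_sub_mono _ _ sDG) R1.
rewrite (_ : D = G); last exact/val_inj.
apply: class_gen_nil_res R1 => // M j nsMG ntM sRM.
have [sMG nMG] := andP nsMG.
have sRG : right_engel_sub G g n \subset G.
  exact: subset_trans (right_engel_sub_der n_gt0 Gg) (der_sub 1 G).
rewrite -quotient_sub1 ?(subset_trans (nil_res_sub _ _ _)) //.
rewrite /quotient morphim_nil_res //.
have defQ : <<coset M g ^: (G / M)>> = G / M.
  rewrite -[in RHS]defD /= /quotient morphim_gen.
    by rewrite -quotient_class // (subsetP nMG).
  by apply: subset_trans nMG; rewrite class_subG.
have := IHm _ (G / M)%G (coset M g) j; rewrite quotient_sol // mem_quotient //.
have ltQG : #|G / M| < #|G| by rewrite ltn_quotient.
have leQN : #|G / M| <= N := leq_trans (ltnW ltQG) leGN.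
rewrite (leq_trans ltQG leGm) leQN => /(_ isT isT isT isT) IHQ.
have /IHQ Q1 : nil_res N j (right_engel_group (G / M) (coset M g) n) = 1%G.
  have <- : (right_engel_group G g n / M)%G
      = right_engel_group (G / M) (coset M g) n.
    by apply/val_inj; rewrite /= quotient_right_engel_sub.
  apply/val_inj; rewrite /= -morphim_nil_res ?(subset_trans sRG) //.
  exact: quotientS1.
have <- : <<coset M g ^: (G / M)>>%G = (coset M @* G)%G by apply/val_inj.
by rewrite Q1.
Qed.

Theorem theorem1p1 (gT : finGroupType) (G : {group gT}) (g : gT) (n k : nat)
    (solG : solvable G) (Gg : g \in G) (n_gt0 : (0 < n)%N)
    (heightR : has_fitting_height (right_engel_sub G g n) k) :
  g \in fitting_series k.+1 G.
Proof.
have nsDG : <<g ^: G>> <| G.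
  by rewrite /normal gen_subG class_subG ?norms_gen ?class_norm.
have sRG : right_engel_sub G g n \subset G.
  exact: subset_trans (right_engel_sub_der n_gt0 Gg) (der_sub 1 G).
have Dg : g \in <<g ^: G>> by rewrite mem_gen ?class_refl.
apply: (subsetP (sub_fitting_series (N := #|G|) _ nsDG _)) => //.
apply: (engel_nil_res solG Gg n_gt0) => //.
(* Since [R] equals its [k]-th Fitting term, its [k]-th residual is trivial. *)
rewrite -(nil_res_fitting_series k (subset_leq_card sRG)).
by congr nil_res; apply/val_inj; rewrite /= heightR.1.
Qed.
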